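(* Let $X$ be a Polish space, $Y$ a separable metric space, and $f\colon X\to Y$ a function. Let $\mathrm{Baire}$ denote the $\sigma$-algebra of subsets of $X$ with the Baire property. Then the game $G^{\mathrm{Baire}}_f$ is determined (i.e. one of the two players has a winning strategy), and \begin{itemize} \item Player I has a winning strategy in $G^{\mathrm{Baire}}_f$ if and only if $f$ is not Baire measurable; \item Player II has a winning strategy in $G^{\mathrm{Baire}}_f$ if and only if $f$ is Baire measurable. \end{itemize}
   Context: For a $\sigma$-algebra $\Sigma$ of subsets of $X$, a function $f\colon X\to Y$ is $\Sigma$-measurable if $f^{-1}[U]\in\Sigma$ for every open $U\subseteq Y$; ''Baire measurable'' means $\Sigma$-measurable with $\Sigma=\mathrm{Baire}$. Put $H(\Sigma):=\{A\subseteq X\colon \forall B\subseteq A,\ B\in\Sigma\}$ and $\Sigma^+:=\Sigma\setminus H(\Sigma)$. The game $G^\Sigma_f$: Player I first plays a set $W\in\Sigma^+$ and Player II answers with a set $U_0$; then at step $n>0$ Player I plays a point $x_n$ and Player II plays a set $U_n$ (order of moves: $W,U_0,x_1,U_1,x_2,U_2,\dots$), with the rules: $x_n\in U_{n-1}$ for every $n>0$; $U_n\in\Sigma^+$ and $U_n\subseteq W$ for every $n\ge 0$. Player II wins if $\langle x_n\rangle$ is convergent in $X$ and $\lim_{n\to\infty}f(x_n)=f(\lim_{n\to\infty}x_n)$ (in particular the limit on the left exists); otherwise Player I wins. The rules are binding: the first player who does not make a legal move loses. The Axiom of Choice is assumed. *)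

(* Defs.v *)
From mathcomp Require Import all_boot all_order all_algebra.
From mathcomp Require Import boolp classical_sets functions cardinality.
From mathcomp Require Import reals topology.

Set Implicit Arguments.
Unset Strict Implicit.
Unset Printing Implicit Defensive.

Import Order.TTheory GRing.Theory Num.Theory.
Local Open Scope classical_set_scope.
Local Open Scope ring_scope.

Definition separable (T : topologicalType) : Prop :=
  exists2 D : set T, countable D & dense D.

Record is_metric (R : realType) (T : Type) (d : T -> T -> R) : Prop := IsMetric {
  dist_ge0 : forall x y, 0 <= d x y;
  dist_eq0 : forall x y, d x y = 0 <-> x = y;
  dist_sym : forall x y, d x y = d y x;
  dist_triangle : forall x y z, d x z <= d x y + d y z }.

Definition induces_topology (R : realType) (T : topologicalType)
    (d : T -> T -> R) : Prop :=
  forall (x : T) (A : set T),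
    nbhs x A <-> exists2 e : R, 0 < e & [set y | d x y < e] `<=` A.

Definition cauchy_seq (R : realType) (T : Type) (d : T -> T -> R)
    (u : nat -> T) : Prop :=
  forall e : R, 0 < e ->
    exists N, forall m n, (N <= m)%N -> (N <= n)%N -> d (u m) (u n) < e.

(* The library's complete (pseudo)metric types are pointed and carry a chosen
   metric; a Polish space may be empty and only its topology is given. *)
Definition completely_metrizable (R : realType) (T : topologicalType) : Prop :=
  exists d : T -> T -> R,
    [/\ is_metric d, induces_topology d &
        forall u, cauchy_seq d u -> exists l : T, u @ \oo --> l].

Definition polish (R : realType) (T : topologicalType) : Prop :=
  separable T /\ completely_metrizable R T.

Definition nowhere_dense (T : topologicalType) (A : set T) : Prop :=
  interior (closure A) = set0.

Definition meager (T : topologicalType) (A : set T) : Prop :=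
  exists2 F : nat -> set T,
    forall n, nowhere_dense (F n) & A = \bigcup_n F n.

Definition Baire (T : topologicalType) : set (set T) :=
  [set A | exists2 U : set T, open U & meager (A `+` U)].
Arguments Baire : clear implicits.

Definition measurable_for (X : Type) (Sigma : set (set X))
    (Y : topologicalType) (f : X -> Y) : Prop :=
  forall U : set Y, open U -> Sigma (f @^-1` U).

Definition hereditary (X : Type) (Sigma : set (set X)) : set (set X) :=
  [set A | forall B, B `<=` A -> Sigma B].

Definition positive (X : Type) (Sigma : set (set X)) : set (set X) :=
  Sigma `\` hereditary Sigma.

(* A run is an infinite sequence of moves, legal or not; Player I makes the
   moves of even index and Player II those of odd index. The predicate
   [legal h m] says that [m] is a legal move at the position [h] (the list of
   all previous moves, oldest first), and [win2 p] that Player II wins the run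
   [p] provided all its moves are legal. A run with an illegal move is lost by
   whoever made the first one, so its remaining moves are irrelevant; in
   particular a player with no legal move loses. *)

Definition legal_at (M : Type) (legal : seq M -> M -> Prop) (p : nat -> M)
    (k : nat) : Prop :=
  legal (mkseq p k) (p k).

Definition first_illegal (M : Type) (legal : seq M -> M -> Prop)
    (p : nat -> M) (k : nat) : Prop :=
  ~ legal_at legal p k /\ forall j, (j < k)%N -> legal_at legal p j.

Definition wins1 (M : Type) (legal : seq M -> M -> Prop)
    (win2 : (nat -> M) -> Prop) (p : nat -> M) : Prop :=
  (exists2 k, odd k & first_illegal legal p k) \/
  ((forall k, legal_at legal p k) /\ ~ win2 p).

Definition wins2 (M : Type) (legal : seq M -> M -> Prop)
    (win2 : (nat -> M) -> Prop) (p : nat -> M) : Prop :=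
  (exists2 k, ~~ odd k & first_illegal legal p k) \/
  ((forall k, legal_at legal p k) /\ win2 p).

Definition strategy (M : Type) : Type := seq M -> M.

Definition follows1 (M : Type) (s : strategy M) (p : nat -> M) : Prop :=
  forall k, ~~ odd k -> p k = s (mkseq p k).

Definition follows2 (M : Type) (s : strategy M) (p : nat -> M) : Prop :=
  forall k, odd k -> p k = s (mkseq p k).

Definition has_winning_strategy1 (M : Type) (legal : seq M -> M -> Prop)
    (win2 : (nat -> M) -> Prop) : Prop :=
  exists s : strategy M, forall p, follows1 s p -> wins1 legal win2 p.

Definition has_winning_strategy2 (M : Type) (legal : seq M -> M -> Prop)
    (win2 : (nat -> M) -> Prop) : Prop :=
  exists s : strategy M, forall p, follows2 s p -> wins2 legal win2 p.

Inductive move (X : Type) : Type :=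
| SetMove of set X
| PointMove of X.

(* The moves of index 0, 1, 2, 3, 4, ... are W, U_0, x_1, U_1, x_2, ...:
   U_n has index 2n+1, and x_n (n > 0) has index 2n, just after U_(n-1). *)
Definition G_legal (X : Type) (Sigma : set (set X))
    (h : seq (move X)) (m : move X) : Prop :=
  match h, m with
  | [::], SetMove W => positive Sigma W
  | SetMove W :: _, SetMove U =>
      [/\ odd (size h), positive Sigma U & U `<=` W]
  | SetMove W :: h', PointMove x =>
      ~~ odd (size h) /\
      exists2 U : set X, last (SetMove W) h' = SetMove U & U x
  | _, _ => False
  end.

(* Only constrained at x_n with n > 0: the value [x 0] is irrelevant. *)
Definition G_win2 (X Y : topologicalType) (f : X -> Y)
    (p : nat -> move X) : Prop :=
  exists (x : nat -> X) (l : X),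
    [/\ forall n, (0 < n)%N -> p n.*2 = PointMove (x n),
        x @ \oo --> l &
        (fun n => f (x n)) @ \oo --> f l].

Definition I_has_winning_strategy (X Y : topologicalType)
    (Sigma : set (set X)) (f : X -> Y) : Prop :=
  has_winning_strategy1 (G_legal Sigma) (G_win2 f).

Definition II_has_winning_strategy (X Y : topologicalType)
    (Sigma : set (set X)) (f : X -> Y) : Prop :=
  has_winning_strategy2 (G_legal Sigma) (G_win2 f).

Definition determined (X Y : topologicalType)
    (Sigma : set (set X)) (f : X -> Y) : Prop :=
  I_has_winning_strategy Sigma f \/ II_has_winning_strategy Sigma f.

(* Main.v *)
Require Import Defs.
From mathcomp Require Import all_boot all_order all_algebra.
From mathcomp Require Import boolp classical_sets functions cardinality.
From mathcomp Require Import reals topology.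

(** The two players cannot both have winning strategies, since these could be
    played against each other ([strategies_exclusive]). So it is enough that
    Player II wins when [f] is Baire measurable and that Player I wins when it
    is not; determinacy and both equivalences follow.

    If [f] is measurable, let Player I open with [W]. Some point [l] is such
    that [A `&` f @^-1` B `&` W] is a legal answer for all open [A] around [l]
    and [B] around [f l]: otherwise [W] would be covered by countably many sets
    of this form, taken from countable bases, all of whose subsets have the
    Baire property, and then every subset of [W] would have it too
    ([measurable_condensation_point]). Player II plays sets of this form with
    [A] and [B] shrinking to [l] and to [f l], ignoring the points chosen by
    Player I, which are thus forced to converge to [l] together with their
    images ([II_wins_shrinking]).

    If [f] is not measurable, then [f @^-1` V] fails the Baire property for
    some open [V]. As [Y] is regular and second countable, [V] is a countable
    union of sets [A n] whose closures lie in [V]. Were each [f @^-1` A n]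
    separated from the complement of [f @^-1` V] by a set with the Baire
    property, up to meager sets, then [f @^-1` V] would have the Baire
    property. So for some [n] the category hulls of these two sets overlap in a
    non-meager set [W], and every set that Player II may play inside [W] meets
    both ([nonBaire_bigcup_inseparable]). Player I opens with [W] and then
    alternates between points of the two: their images are alternately in [A n]
    and outside [V], and a limit would belong both to the closure of [A n],
    hence to [V], and to the closed complement of [V]
    ([I_wins_separated]). *)

Set Implicit Arguments.
Unset Strict Implicit.
Unset Printing Implicit Defensive.

Import Order.TTheory GRing.Theory Num.Theory.
Local Open Scope classical_set_scope.
Local Open Scope ring_scope.

(** * Countable bases *)

(** The balls of radius [1 / n.+1] around the points of a countable dense set
    form a base: if [x] lies within [1 / n.+1 < e / 2] of a center, the ball
    around that center stays within [e] of [x]. *)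
Lemma separable_metric_second_countable (R : realType) (T : topologicalType)
    (d : T -> T -> R) :
  is_metric d -> induces_topology d -> separable T -> @second_countable T.
Proof.
move=> dm dT [D Dcount Ddense].
pose b q n := [set y | d q y < n.+1%:R^-1].
have bopen q n : open (b q n).
  rewrite openE => y /= qy; apply/dT; exists (n.+1%:R^-1 - d q y).
    by rewrite subr_gt0.
  move=> z /= yz; apply: le_lt_trans (dist_triangle dm q y z) _.
  by rewrite addrC -ltrBrDr.
exists (\bigcup_n (b^~ n @` D)).
  apply: bigcup_countable => // n _.
  exact: sub_countable (card_image_le _ _) Dcount.
split=> [_ [n _ [q _ <-]]|x A /dT [e e0 eA]]; first exact: bopen.
have [n ne] : exists n : nat, n.+1%:R^-1 < e / 2.
  have e20 : 0 < e / 2 by rewrite divr_gt0.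
  by have [n] := ltr_add_invr e20; rewrite add0r; exists n.
have [q [/= xq Dq]] : (b x n `&` D) !=set0.
  apply: Ddense (bopen x n); exists x.
  by rewrite /b /= (dist_eq0 dm x x).2 ?invr_gt0 ?ltr0n.
exists (b q n).
  by split; [exists n => //; exists q|rewrite /b /= (dist_sym dm)].
move=> z /= qz; apply: eA; rewrite /=.
apply: le_lt_trans (dist_triangle dm x q z) _.
rewrite (splitr e); apply: ltrD; exact: lt_trans ne.
Qed.

Lemma mdist_is_metric (R : realType) (T : metricType R) : is_metric (@mdist R T).
Proof.
split=> [x y|x y|x y|x y z].
- exact: mdist_ge0.
- by split=> [/mdist_positivity|->]; rewrite ?mdistxx.
- exact: metric_sym.
- exact: metric_triangle.
Qed.

Lemma mdist_induces_topology (R : realType) (T : metricType R) :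
  induces_topology (@mdist R T).
Proof.
move=> x A; rewrite -(metricType_numDomainType.nbhs_nbhs_mdist (V := T)).
by split=> -[e e0 eA]; exists e.
Qed.

(** The base is numbered by an injection into [nat], which may skip numbers;
    taking the union of the elements with number [n], of which there is at most
    one, assigns the empty set to the skipped ones. *)
Lemma second_countable_sequence (T : topologicalType) :
  @second_countable T ->
  exists O : nat -> set T, (forall n, open (O n)) /\
    forall x A, nbhs x A -> exists2 n, O n x & O n `<=` A.
Proof.
move=> [B /countable_injP [g ginj] [Bopen Bbase]].
exists (fun n => \bigcup_(b in [set b | B b /\ g b = n]) b); split.
  by move=> n; apply: bigcup_open => b [] /Bopen.
move=> x A /Bbase [b [Bb bx] bA]; exists (g b); first by exists b.
by move=> y [c [Bc gcb] cy]; apply: bA; rewrite -(ginj c b) ?inE.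
Qed.

Lemma second_countable_shrinking_nbhs (T : topologicalType) (x : T) :
  @second_countable T ->
  exists N : nat -> set T, (forall n, open_nbhs x (N n)) /\
    forall A, nbhs x A -> \forall n \near \oo, N n `<=` A.
Proof.
move=> /second_countable_sequence [O [Oopen Obase]].
exists (fun n => \bigcap_(k in [set k | (k < n)%N /\ O k x]) O k); split.
  move=> n; split; last by move=> k [].
  rewrite -closedC setC_bigcap; apply: closed_bigcup.
    by apply: sub_finite_set (finite_II n) => k [].
  by move=> k _; exact: open_closedC.
move=> A /Obase [k Okx OkA]; near=> n => y Ny; apply/OkA/Ny; split=> //.
by near: n; exact: nbhs_infty_gt.
Unshelve. all: by end_near. Qed.

(** * Meager sets *)

Section Meager.
Variable T : topologicalType.
Implicit Types A B E S U : set T.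

Lemma nowhere_dense_sub A B : A `<=` B -> nowhere_dense B -> nowhere_dense A.
Proof.
move=> AB B0; apply/seteqP; split=> // x.
by move/(interiorS (closureS AB)); rewrite B0.
Qed.

Lemma nowhere_dense_meager A : nowhere_dense A -> meager A.
Proof. by move=> A0; exists (fun=> A) => //; rewrite bigcup_const. Qed.

Lemma meager0 : meager (@set0 T).
Proof. by apply: nowhere_dense_meager; rewrite /nowhere_dense closure0 interior0. Qed.

Lemma meager_sub A B : A `<=` B -> meager B -> meager A.
Proof.
move=> AB [F Fnd BF]; exists (fun n => A `&` F n).
  by move=> n; exact: nowhere_dense_sub (Fnd n).
rewrite -setI_bigcupr -BF; apply/esym/setIidl/AB.
Qed.

Lemma meager_bigcup (I : countType) (A : I -> set T) :
  (forall i, meager (A i)) -> meager (\bigcup_i A i).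
Proof.
move=> mA.
have [F FA] : exists F : I -> nat -> set T, forall i,
    (forall n, nowhere_dense (F i n)) /\ A i = \bigcup_n F i n.
  have /choice[F] : forall i, exists G : nat -> set T,
    (forall n, nowhere_dense (G n)) /\ A i = \bigcup_n G n.
    by move=> i; have [G] := mA i; exists G.
  by exists F.
pose G k := if unpickle k is Some p then F p.1 p.2 else set0.
exists G => [k|].
  rewrite /G; case: unpickle => [p|]; first exact: (FA _).1.
  by rewrite /nowhere_dense closure0 interior0.
apply/seteqP; split=> [x [i _]|x [k _]].
  by rewrite (FA i).2 => -[n _ Fx]; exists (pickle (i, n)) => //; rewrite /G pickleK.
rewrite /G; case: unpickle => [[i n] Fx|//].
by exists i => //; rewrite (FA i).2; exists n.
Qed.

Lemma meagerU A B : meager A -> meager B -> meager (A `|` B).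
Proof.
move=> mA mB; apply: (@meager_sub _ (\bigcup_(b : bool) if b then A else B)).
  by move=> x [?|?]; [exists true|exists false].
by apply: meager_bigcup => -[].
Qed.

(** The boundary [closure U `\` U] is closed, and an open subset of it would
    lie in [closure U] while missing [U]. *)
Lemma boundary_open_nowhere_dense U :
  open U -> nowhere_dense (closure U `\` U).
Proof.
move=> Uopen; rewrite /nowhere_dense setDE -(closure_id _).1.
  by rewrite interiorI interiorC; apply/seteqP; split=> // x [] /interior_subset.
by apply: closedI; [exact: closed_closure|exact: open_closedC].
Qed.

(** * The sigma-algebra of sets with the Baire property *)

Lemma open_Baire U : open U -> Baire T U.
Proof. by move=> Uo; exists U => //; rewrite setYK; exact: meager0. Qed.

Lemma meager_Baire A : meager A -> Baire T A.
Proof. by move=> mA; exists set0; [exact: open0|rewrite setY0]. Qed.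

Lemma Baire_congr A E : Baire T E -> meager (A `+` E) -> Baire T A.
Proof.
move=> [U Uo EU] AE; exists U => //; apply: meager_sub (meagerU AE EU).
by move=> x /=; case: (pselect (E x)); tauto.
Qed.

(** If [A] is an open [U] up to a meager set, then its complement is
    [~` closure U] up to the same meager set and the boundary of [U]. *)
Lemma Baire_setC A : Baire T A -> Baire T (~` A).
Proof.
move=> [U Uo AU]; exists (~` closure U); first exact/closed_openC/closed_closure.
have bU := nowhere_dense_meager (boundary_open_nowhere_dense Uo).
apply: meager_sub (meagerU AU bU) => x /=.
have := @subset_closure _ U x.
case: (pselect (A x)); case: (pselect (closure U x)); case: (pselect (U x));
  tauto.
Qed.

Lemma Baire_bigcup (A : nat -> set T) :
  (forall n, Baire T (A n)) -> Baire T (\bigcup_n A n).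
Proof.
move=> BA.
have /choice[U UA] : forall n, exists U, open U /\ meager (A n `+` U).
  by move=> n; have [U] := BA n; exists U.
exists (\bigcup_n U n); first by apply: bigcup_open => n _; exact: (UA n).1.
apply: meager_sub (meager_bigcup (fun n => (UA n).2)).
move=> x [[[n _ Ax] nU]|[[n _ Ux] nA]]; exists n => //.
  by left; split=> // ?; apply: nU; exists n.
by right; split=> // ?; apply: nA; exists n.
Qed.

Lemma Baire_setU A B : Baire T A -> Baire T B -> Baire T (A `|` B).
Proof.
move=> BA BB; rewrite (_ : _ `|` _ = \bigcup_n if n is 0%N then A else B).
  by apply: Baire_bigcup => -[].
apply/seteqP; split=> x; first by case=> ?; [exists 0%N|exists 1%N].
by case=> -[|n] _ ?; [left|right].
Qed.

Lemma Baire_setI : setI_closed (Baire T).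
Proof.
move=> A B BA BB; rewrite -[X in Baire T X]setCK setCI.
by apply/Baire_setC/Baire_setU; exact: Baire_setC.
Qed.

(** Subsets of meager sets are meager, hence have the Baire property: meager
    sets are hereditary. *)
Lemma positive_nonmeager A : positive (Baire T) A -> ~ meager A.
Proof.
by move=> [_ nH] mA; apply: nH => B BA; exact/meager_Baire/(meager_sub BA).
Qed.

(** * Locating the failure of the Baire property *)

(** Its complement is the category hull of [S]: a closed set that contains [S]
    up to a meager set and is, by [Baire_avoiding_meager], the least such set
    with the Baire property, up to meager sets. *)
Definition meager_locus S : set T :=
  \bigcup_(O in [set O | open O /\ meager (O `&` S)]) O.

Lemma open_meager_locus S : open (meager_locus S).
Proof. by apply: bigcup_open => O []. Qed.

(** A union of arbitrarily many open sets in each of which [S] is meager is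
    covered by countably many basic ones with the same property. *)
Lemma meager_meager_locus S :
  @second_countable T -> meager (meager_locus S `&` S).
Proof.
move=> /second_countable_sequence [O [Oopen Obase]].
pose M n := [set x | (O n `&` S) x /\ meager (O n `&` S)].
apply: (@meager_sub _ (\bigcup_n M n)).
  move=> x [[U [Uopen mU] Ux] Sx].
  have [n Onx OnU] := Obase x U (open_nbhs_nbhs (conj Uopen Ux)).
  by exists n => //; split=> //; apply: meager_sub mU; exact: setSI.
apply: meager_bigcup => n.
have [mO|nO] := pselect (meager (O n `&` S)).
  by apply: meager_sub mO => x [].
by apply: meager_sub meager0 => x [].
Qed.

(** Up to a meager set, [U] is an open [O]; then [S] is meager in [O] too,
    which places [O] inside the locus. *)
Lemma Baire_avoiding_meager S U :
  Baire T U -> meager (U `&` S) -> meager (U `\` meager_locus S).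
Proof.
move=> [O Oopen UO] US.
have OU : meager (O `\` U) by apply: meager_sub UO => y; right.
apply: meager_sub UO => x [Ux nlx]; left; split=> // Ox.
apply: nlx; exists O => //; split=> //.
apply: meager_sub (meagerU US OU) => y [Oy Sy].
by case: (pselect (U y)); [left|right].
Qed.

(** The category hulls of the [A n] cover the union of the [A n] up to a meager
    set. As this union fails the Baire property, some hull contains a
    non-meager part of the complement [B] of the union; [W] is the overlap of
    that hull with the hull of [B]. A subset of [W] with the Baire property
    that misses [A n] or [B] is then meager. The same fact shows that [W]
    itself is not hereditary: otherwise [W `\` A n] and [W `\` B] would have
    the Baire property, hence be meager, and they cover [W]. *)
Lemma nonBaire_bigcup_inseparable (A : nat -> set T) :
  @second_countable T -> ~ Baire T (\bigcup_n A n) ->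
  exists n W, positive (Baire T) W /\
    forall U, positive (Baire T) U -> U `<=` W ->
      U `&` A n !=set0 /\ U `\` \bigcup_n A n !=set0.
Proof.
move=> scT nBA; pose B := ~` \bigcup_n A n.
have [n nB] : exists n, ~ meager (B `\` meager_locus (A n)).
  apply: contrapT => /forallNP/(_ _)/contrapT mB; apply: nBA.
  apply: (@Baire_congr _ (\bigcup_n ~` meager_locus (A n))).
    by apply: Baire_bigcup => n; apply/Baire_setC/open_Baire/open_meager_locus.
  have mA := meager_bigcup (fun n => meager_meager_locus (A n) scT).
  apply: meager_sub (meagerU mA (meager_bigcup mB)).
  move=> x [[[n _ Ax] nE]|[[n _ nlx] nA]]; last by right; exists n.
  by left; exists n => //; split=> //; apply: contrapT => nl; apply: nE; exists n.
pose W := ~` meager_locus (A n) `\` meager_locus B.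
have BaireW : Baire T W.
  by apply: Baire_setI; apply/Baire_setC/open_Baire/open_meager_locus.
have WmA U : Baire T U -> U `<=` W -> meager (U `&` A n) -> meager U.
  move=> BU UW /(Baire_avoiding_meager BU); apply: meager_sub => x Ux.
  by split=> //; have [] := UW x Ux.
have WmB U : Baire T U -> U `<=` W -> meager (U `&` B) -> meager U.
  move=> BU UW /(Baire_avoiding_meager BU); apply: meager_sub => x Ux.
  by split=> //; have [] := UW x Ux.
have AB x : A n x -> ~ B x by move=> Ax; apply; exists n.
have nW : ~ meager W.
  move=> mW; apply: nB.
  apply: meager_sub (meagerU mW (meager_meager_locus B scT)) => x [Bx nlx].
  by case: (pselect (meager_locus B x)); [right|left].
exists n, W; split.
  split=> // hW; apply: nW.
  have mWA : meager (W `\` A n).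
    apply: WmA; [by apply: hW; exact: subDsetl|exact: subDsetl|].
    by rewrite setDE -setIA setICl setI0; exact: meager0.
  have mWB : meager (W `\` B).
    apply: WmB; [by apply: hW; exact: subDsetl|exact: subDsetl|].
    by rewrite setDE -setIA setICl setI0; exact: meager0.
  apply: meager_sub (meagerU mWA mWB) => x Wx.
  by case: (pselect (A n x)) => [/AB|]; [right|left].
move=> U Upos UW; have nU := positive_nonmeager Upos; have [BU _] := Upos.
split; apply/set0P/eqP => U0; apply: nU.
  by apply: WmA => //; rewrite U0; exact: meager0.
by apply: WmB => //; rewrite -setDE U0; exact: meager0.
Qed.

End Meager.

(** * The game *)

Section Games.
Variables (M : Type) (legal : seq M -> M -> Prop) (win2 : (nat -> M) -> Prop).

Lemma first_illegalP (p : nat -> M) :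
  (forall k, legal_at legal p k) \/ exists k, first_illegal legal p k.
Proof.
have [?|/existsNP [k nk]] := pselect (forall k, legal_at legal p k); [by left|right].
have ex : exists k, `[< ~ legal_at legal p k >] by exists k; apply/asboolP.
case: (ex_minnP ex) => m /asboolP nm m_min; exists m; split=> // j jm.
apply: contrapT => nj; have : (m <= j)%N by apply/m_min/asboolP.
by rewrite leqNgt jm.
Qed.

Lemma wins_exclusive (p : nat -> M) : wins1 legal win2 p -> ~ wins2 legal win2 p.
Proof.
have uniq i j : first_illegal legal p i -> first_illegal legal p j -> i = j.
  move=> [ni li] [nj lj]; case: (ltngtP i j) => // ij; first by have := lj _ ij.
  by have := li _ ij.
move=> [[i oi fi]|[lp nw]] [[j oj fj]|[lp' w]] //.
- by move: oj; rewrite -(uniq _ _ fi fj) oi.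
- by case: fi => + _; apply.
- by case: fj => + _; apply.
Qed.

(** A run in which both players follow their strategies would be won by
    both. *)
Lemma strategies_exclusive :
  has_winning_strategy1 legal win2 -> ~ has_winning_strategy2 legal win2.
Proof.
move=> [s1 w1] [s2 w2].
pose s (h : seq M) := if odd (size h) then s2 h else s1 h.
(* The positions of the run in which both strategies are followed. *)
pose h k := iter k (fun h => rcons h (s h)) [::].
pose p k := s (h k).
have hE k : mkseq p k = h k by elim: k => // k IH; rewrite mkseqS IH.
have pE k : p k = if odd k then s2 (mkseq p k) else s1 (mkseq p k).
  by rewrite {1}/p -hE /s size_mkseq.
apply: (@wins_exclusive p); [apply: w1 => k|apply: w2 => k].
  by rewrite pE => /negbTE ->.
by rewrite pE => ->.
Qed.

End Games.

Section SetPointGame.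
Variables (X : Type) (Sigma : set (set X)).
Implicit Types (p : nat -> move X) (W U : set X).

Lemma legal_at0P p :
  legal_at (G_legal Sigma) p 0 <-> exists2 W, p 0%N = SetMove W & positive Sigma W.
Proof.
rewrite /legal_at /mkseq /=; case: (p 0%N) => [W|x]; split=> //.
- by exists W.
- by move=> [W' [->]].
- by case.
Qed.

Lemma legal_at_oddP p W k : p 0%N = SetMove W -> odd k ->
  legal_at (G_legal Sigma) p k <->
  exists U, [/\ p k = SetMove U, positive Sigma U & U `<=` W].
Proof.
case: k => // k p0 ok; rewrite /legal_at /mkseq /= p0 size_map size_iota.
case: (p k.+1) => [U|x]; split.
- by move=> [_ Upos UW]; exists U.
- by move=> [U' [[<-]]].
- by move: ok => /= -> [].
- by move=> [U []].
Qed.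

Lemma legal_at_evenP p W k : p 0%N = SetMove W -> odd k ->
  legal_at (G_legal Sigma) p k.+1 <->
  exists x U, [/\ p k.+1 = PointMove x, p k = SetMove U & U x].
Proof.
move=> p0 ok.
rewrite /legal_at /mkseq /= p0 /= size_map size_iota.
rewrite -[X in last X]p0 last_map (_ : last _ _ = k); last first.
  by rewrite -nth_last size_iota; case: k ok => // k _; rewrite nth_iota.
case: (p k.+1) => [U|x]; split.
- by move=> []; rewrite /= ok.
- by move=> [x [U' []]].
- by move=> [_ [U pk Ux]]; exists x, U.
- move=> [_ [U [[<-] pk Ux]]]; split; last by exists U.
  by rewrite /= negbK.
Qed.

End SetPointGame.

(** * Winning strategies *)

Section WinningStrategies.
Variables (X Y : topologicalType) (Sigma : set (set X)) (f : X -> Y).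

(** Player I answers each set with a point of [f @^-1` E] or of [f @^-1` F],
    in alternation, so that a limit of the images would lie in both
    closures. *)
Lemma I_wins_separated W (E F : set Y) :
  positive Sigma W ->
  (forall U, positive Sigma U -> U `<=` W ->
    U `&` f @^-1` E !=set0 /\ U `&` f @^-1` F !=set0) ->
  closure E `&` closure F = set0 ->
  I_has_winning_strategy Sigma f.
Proof.
move=> Wpos meetsEF EF0; pose target (b : bool) := if b then E else F.
have /choice[c cP] : forall bU : bool * set X, exists m : move X,
    positive Sigma bU.2 -> bU.2 `<=` W ->
    exists x, [/\ m = PointMove x, bU.2 x & target bU.1 (f x)].
  move=> [b U] /=.
  have [[Upos UW]|nU] := pselect (positive Sigma U /\ U `<=` W); last first.
    by exists (SetMove W) => Upos UW; case: nU.
  have [[x [Ux Ex]] [y [Uy Fy]]] := meetsEF U Upos UW.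
  by case: b; [exists (PointMove x) => _ _; exists x
              |exists (PointMove y) => _ _; exists y].
(* At a position of size [n.*2] Player I is about to choose [x_n]; the parity
   of [n] decides between [E] and [F]. *)
pose s (h : seq (move X)) :=
  if (nilp h, last (SetMove W) h) is (false, SetMove U)
  then c (odd (size h)./2, U) else SetMove W.
exists s => p sp.
have p0 : p 0%N = SetMove W by rewrite sp.
have reply k : odd k -> legal_at (G_legal Sigma) p k ->
    legal_at (G_legal Sigma) p k.+1 /\
    exists2 x, p k.+1 = PointMove x & target (odd k.+1./2) (f x).
  move=> ok /(legal_at_oddP Sigma p0 ok) [U [pk Upos UW]].
  have [x [cx Ux fx]] := cP (odd k.+1./2, U) Upos UW.
  have px : p k.+1 = PointMove x.
    rewrite sp; last by rewrite /= ok.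
    by rewrite /s /nilp size_mkseq mkseqS last_rcons pk.
  split; last by exists x.
  by apply/(legal_at_evenP Sigma p0 ok); exists x, U.
have [lp|[k fk]] := first_illegalP (G_legal Sigma) p; last first.
  case ok: (odd k); first by left; exists k.
  case: k ok fk => [_ [nl _]|k /= /negbFE ok [nl lt]].
    by case: nl; apply/legal_at0P; exists W.
  by case: nl; exact: (reply k ok (lt k (ltnSn k))).1.
right; split=> // -[x [l [px _ fxl]]].
have xP n : target (odd n.+1) (f (x n.+1)).
  have ok : odd n.*2.+1 by rewrite /= odd_double.
  have [_ [y py]] := reply _ ok (lp _).
  by rewrite -doubleS doubleK; move: py; rewrite -doubleS px // => -[<-].
suff : (closure E `&` closure F) (f l) by rewrite EF0.
split=> B /fxl [N _ NB].
  exists (f (x N.*2.+1)); split; last first.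
    by apply: NB; rewrite /= -addnn (leq_trans (leq_addr N N)).
  by have := xP N.*2; rewrite /= odd_double.
exists (f (x N.*2.+2)); split; last first.
  by apply: NB; rewrite /= -addnn (leq_trans (leq_addr N N)) // -addn2 leq_addr.
by have := xP N.*2.+1; rewrite /= odd_double.
Qed.

(** The sets to be played are fixed as soon as [W] is known, and the legality
    of Player I's points alone makes them, and their images, converge. *)
Lemma II_wins_shrinking :
  (forall W, positive Sigma W -> exists (U : nat -> set X) (l : X),
    [/\ forall n, positive Sigma (U n) /\ U n `<=` W,
        forall A, nbhs l A -> \forall n \near \oo, U n `<=` A &
        forall B, nbhs (f l) B -> \forall n \near \oo, U n `<=` f @^-1` B]) ->
  II_has_winning_strategy Sigma f.
Proof.
move=> shrink.
have /choice[S SP] : forall W, exists U : nat -> set X, positive Sigma W ->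
    (forall n, positive Sigma (U n) /\ U n `<=` W) /\
    exists l, (forall A, nbhs l A -> \forall n \near \oo, U n `<=` A) /\
      (forall B, nbhs (f l) B -> \forall n \near \oo, U n `<=` f @^-1` B).
  move=> W; have [Wpos|nW] := pselect (positive Sigma W); last by exists (fun=> W).
  have [U [l [? ? ?]]] := shrink W Wpos.
  by exists U => _; split=> //; exists l.
(* At a position of size [n.*2.-1] the answer is [U n], so that the next
   point [x_n] of Player I lies in [U n]. *)
pose s (h : seq (move X)) :=
  if h is SetMove W :: _ then SetMove (S W (size h).+1./2) else SetMove set0.
exists s => p sp.
have reply W k : p 0%N = SetMove W -> odd k -> p k = SetMove (S W k.+1./2).
  move=> p0 ok; rewrite sp // -[k in RHS](size_mkseq p).
  by case: k ok => // k _; rewrite /mkseq /= p0.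
have [lp|[k fk]] := first_illegalP (G_legal Sigma) p; last first.
  case ok: (odd k); last by left; exists k => //; rewrite ok.
  case: fk => nl lt.
  have k0 : (0 < k)%N by case: (k) ok.
  have [W p0 Wpos] := (legal_at0P Sigma p).1 (lt 0%N k0).
  case: nl; apply/(legal_at_oddP Sigma p0 ok).
  exists (S W k.+1./2); split; first exact: reply.
    exact: ((SP W Wpos).1 _).1.
  exact: ((SP W Wpos).1 _).2.
right; split=> //.
have [W p0 Wpos] := (legal_at0P Sigma p).1 (lp 0%N).
have [_ [l [Sl Sfl]]] := SP W Wpos.
have /choice[x xP] : forall n, exists y, (0 < n)%N ->
    p n.*2 = PointMove y /\ S W n y.
  case=> [|n]; first by exists l.
  have ok : odd n.*2.+1 by rewrite /= odd_double.
  have [y [U [py]]] := (legal_at_evenP Sigma p0 ok).1 (lp _).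
  rewrite (reply W) // -doubleS doubleK => -[<-] Sy.
  by exists y.
have xS : \forall n \near \oo, S W n (x n).
  by apply: filterS (nbhs_infty_gt 0) => n /xP [].
exists x, l; split.
- by move=> n /xP [].
- move=> A /Sl; apply: filterS2 xS => n Sx; exact.
- move=> B /Sfl; apply: filterS2 xS => n Sx SB; exact: SB Sx.
Qed.

Hypotheses (SigmaI : setI_closed Sigma) (Sigma_open : open `<=` Sigma).
Hypothesis Sigma_bigcup :
  forall A : nat -> set X, (forall n, Sigma (A n)) -> Sigma (\bigcup_n A n).

(** If every point [x] had neighborhoods [A] of [x] and [B] of [f x] that
    violate the conclusion, they could be taken in countable bases. The sets
    [A `&` f @^-1` B `&` W] are in [Sigma] by measurability, so the violating
    ones are hereditary; being countably many and covering [W], they make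
    [W] hereditary. *)
Lemma measurable_condensation_point W :
  @second_countable X -> @second_countable Y -> measurable_for Sigma f ->
  positive Sigma W ->
  exists l, forall A B, open_nbhs l A -> open_nbhs (f l) B ->
    positive Sigma (A `&` f @^-1` B `&` W).
Proof.
move=> /second_countable_sequence [O [Oopen Obase]].
move=> /second_countable_sequence [V [Vopen Vbase]] fmeas [SW nH].
apply: contrapT => /forallNP nl; apply: nH => B BW.
(* The pieces of [B] cut out by the hereditary basic sets. *)
pose H k := if unpickle k is Some p then
  [set x | [/\ B x, O p.1 x, V p.2 (f x) &
    hereditary Sigma (O p.1 `&` f @^-1` V p.2 `&` W)]] else set0.
rewrite (_ : B = \bigcup_k H k).
  apply: Sigma_bigcup => k; rewrite /H.
  case: unpickle => [[i j] /=|]; last exact/Sigma_open/open0.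
  have [h|nh] := pselect (hereditary Sigma (O i `&` f @^-1` V j `&` W)).
    by apply: h => x [Bx Ox Vx _]; split=> //; exact: BW.
  rewrite (_ : mkset _ = set0); first exact/Sigma_open/open0.
  by apply/seteqP; split=> x // [].
apply/seteqP; split=> x; last first.
  by move=> [k _]; rewrite /H; case: unpickle => // p [].
move=> Bx; have /existsNP [A /existsNP [C]] := nl x.
move=> /not_implyP [xA /not_implyP [fxC np]].
have [i Ox OA] := Obase _ _ (open_nbhs_nbhs xA).
have [j Vx VC] := Vbase _ _ (open_nbhs_nbhs fxC).
exists (pickle (i, j)) => //; rewrite /H pickleK; split=> // D DOVW.
apply: contrapT => nD; apply: np; split.
  apply: SigmaI => //; apply: SigmaI; first by apply: Sigma_open; case: xA.
  by apply: fmeas; case: fxC.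
move=> h; apply: nD; apply: h => y /DOVW [[Oy Vy] Wy].
by split=> //; split; [exact: OA|exact: VC].
Qed.

Lemma measurable_II_wins :
  @second_countable X -> @second_countable Y -> measurable_for Sigma f ->
  II_has_winning_strategy Sigma f.
Proof.
move=> scX scY fmeas; apply: II_wins_shrinking => W Wpos.
have [l lP] := measurable_condensation_point scX scY fmeas Wpos.
have [M [Ml MA]] := second_countable_shrinking_nbhs l scX.
have [N [Nl NB]] := second_countable_shrinking_nbhs (f l) scY.
exists (fun n => M n `&` f @^-1` N n `&` W), l; split.
- by move=> n; split; [exact: lP|exact: subIsetr].
- by move=> A /MA; apply: filterS => n MnA x [[/MnA]].
- by move=> B /NB; apply: filterS => n NnB x [[_ /NnB]].
Qed.

End WinningStrategies.

Lemma nonmeasurable_I_wins (X Y : topologicalType) (f : X -> Y) :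
  @second_countable X -> @second_countable Y -> regular_space Y ->
  ~ measurable_for (Baire X) f -> I_has_winning_strategy (Baire X) f.
Proof.
move=> scX /second_countable_sequence [O [_ Obase]] regY.
move=> /existsNP [V /not_implyP [Vopen nBV]].
pose A n := [set y | O n y /\ closure (O n) `<=` V].
have VA : V = \bigcup_n A n.
  apply/seteqP; split=> y; last by move=> [n _ [/subset_closure Oy]]; apply.
  move=> Vy; have [N yN NV] := regY y V (open_nbhs_nbhs (conj Vopen Vy)).
  have [n Oy ON] := Obase _ _ yN; exists n => //; split=> //.
  exact: subset_trans (closureS ON) NV.
have fV : f @^-1` V = \bigcup_n f @^-1` A n by rewrite {1}VA preimage_bigcup.
rewrite fV in nBV.
have [n [W [Wpos WP]]] := nonBaire_bigcup_inseparable scX nBV.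
apply: (@I_wins_separated _ _ _ _ W (A n) (~` V)) => //.
  move=> U Upos UW; have [? UV] := WP U Upos UW; split=> //.
  by move: UV; rewrite -fV.
rewrite -(closure_id (~` V)).1; last exact: open_closedC.
apply/seteqP; split=> // y [yA nVy]; apply: nVy.
have [_ [[_ AV] _]] := yA setT filterT.
by apply: AV; apply: closureS yA => z [].
Qed.

Theorem theorem12 (R : realType) (X : topologicalType) (Y : metricType R)
    (f : X -> Y) (X_polish : polish R X) (Y_separable : separable Y) :
  determined (Baire X) f /\
  (I_has_winning_strategy (Baire X) f <-> ~ measurable_for (Baire X) f) /\
  (II_has_winning_strategy (Baire X) f <-> measurable_for (Baire X) f).
Proof.
have [sepX [d [dm dX _]]] := X_polish.
have scX := separable_metric_second_countable dm dX sepX.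
have scY : @second_countable Y.
  apply: (separable_metric_second_countable (mdist_is_metric Y)) => //.
  exact: mdist_induces_topology.
have I_wins : ~ measurable_for (Baire X) f -> I_has_winning_strategy (Baire X) f.
  exact: (nonmeasurable_I_wins scX scY (@uniform_regular Y)).
have II_wins : measurable_for (Baire X) f -> II_has_winning_strategy (Baire X) f.
  apply: (measurable_II_wins (@Baire_setI X)) => //; first exact: open_Baire.
  exact: Baire_bigcup.
have excl : I_has_winning_strategy (Baire X) f -> ~ II_has_winning_strategy (Baire X) f.
  exact: strategies_exclusive.
split; first by case: (pselect (measurable_for (Baire X) f)) => ?; [right|left]; auto.
split; split=> //.
  by move=> w1 /II_wins; exact: excl.
by move=> w2; apply: contrapT => /I_wins w1; exact: excl w2.
Qed.
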